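(* The function $\mathbf{x}\mapsto h_s\big(\boldsymbol{\lambda}(\mathbf{V}\,\mathrm{Diag}(\mathbf{x})\,\mathbf{V}^\top)\big)$ is a convex function of $\mathbf{x}$ (on the set of $\mathbf{x}$ for which $\mathbf{V}\mathrm{Diag}(\mathbf{x})\mathbf{V}^\top\succeq0$), and the majorization-based relaxation and the $\Gamma$ (factorization) relaxation are the same, i.e., $$\min_{\mathbf{x}\in\mathcal{X}} g_s\big(\boldsymbol{\lambda}(\mathbf{V}\,\mathrm{Diag}(\mathbf{x})\,\mathbf{V}^\top)\big)=\min_{\mathbf{x}\in\mathcal{X}} h_s\big(\boldsymbol{\lambda}(\mathbf{V}\,\mathrm{Diag}(\mathbf{x})\,\mathbf{V}^\top)\big).$$
   Context: $\varphi:\mathbb{R}_{++}\to\mathbb{R}$ is a closed, convex, nonincreasing function, extended by $+\infty$ outside $\mathbb{R}_{++}$ (closed: the extension is lower semicontinuous). $1\le s\le d$ is an integer, $\mathbf{V}\in\mathbb{R}^{d\times d}$, $\mathbf{C}=\mathbf{V}^\top\mathbf{V}$ with $s\le\operatorname{rank}(\mathbf{C})$, and $\mathcal{X}=\{\mathbf{x}\in[0,1]^d:\ \mathbf{1}^\top\mathbf{x}=s,\ \mathbf{A}\mathbf{x}\le\mathbf{b}\}$ for a given matrix $\mathbf{A}$ and vector $\mathbf{b}$. $\boldsymbol{\lambda}(\mathbf{X})$ is the vector of eigenvalues of a symmetric matrix in nonincreasing order. $\mathbb{K}_{o,d}=\{\mathbf{x}\in\mathbb{R}^d: x_1\ge\dots\ge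 x_d\}$. $\mathbf{u}\succcurlyeq_m\mathbf{w}$ (majorization) means $\sum_i u_i=\sum_i w_i$ and for each $j\le d-1$ the sum of the $j$ largest entries of $\mathbf{u}$ is at least that of $\mathbf{w}$. $f_s(\boldsymbol{\xi})=\sum_{i=1}^s\varphi(\xi_i)$ and $$g_s(\boldsymbol{\lambda})=\min_{\boldsymbol{\xi}\in\mathbb{R}^d_+}\{f_s(\boldsymbol{\xi}):\ \boldsymbol{\xi}\succcurlyeq_m\boldsymbol{\lambda},\ \boldsymbol{\xi}\in\mathbb{K}_{o,d}\}.$$ For $\boldsymbol{\lambda}\in\mathbb{R}^d_+$, let $\lambda_{[i]}$ be its $i$-th largest entry, $\lambda_{[0]}=+\infty$. It is known that there is a unique integer $0\le k<s$ with $\lambda_{[k]}>\frac1{s-k}\sum_{i=k+1}^d\lambda_{[i]}\ge\lambda_{[k+1]}$; with this $k$, $$h_s(\boldsymbol{\lambda})=\sum_{i=1}^k\varphi(\lambda_{[i]})+(s-k)\,\varphi\Big(\frac1{s-k}\sum_{i=k+1}^d\lambda_{[i]}\Big).$$ *)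

(* Defs.v *)
From HB Require Import structures.
From mathcomp Require Import all_boot all_order all_algebra.
From mathcomp Require Import all_classical all_reals all_analysis.

Set Implicit Arguments.
Unset Strict Implicit.
Unset Printing Implicit Defensive.

Import Order.TTheory GRing.Theory Num.Theory.
Import numFieldNormedType.Exports.

Local Open Scope classical_set_scope.
Local Open Scope ring_scope.

Definition ext_pos (R : realType) (phi : R -> R) (t : R) : \bar R :=
  if 0 < t then (phi t)%:E else +oo%E.

(* Vectors are rows, with 0-based indices: the textbook entry x_i is
   x 0 (i - 1), and the index ranges below are shifted accordingly. *)

Definition nonneg_vec (R : realType) (d : nat) (x : 'rV[R]_d) :=
  forall i, 0 <= x 0 i.

Definition nonincreasing_vec (R : realType) (d : nat) (x : 'rV[R]_d) :=
  forall i j : 'I_d, (i <= j)%N -> x 0 j <= x 0 i.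

(* (desc_entries x)`_i is x_[i+1], the (i+1)-th largest entry of x. *)
Definition desc_entries (R : realType) (d : nat) (x : 'rV[R]_d) : seq R :=
  sort >=%R [seq x 0 i | i : 'I_d].

(* nth_largest x i is x_[i], with x_[0] = +oo. *)
Definition nth_largest (R : realType) (d : nat) (x : 'rV[R]_d) (i : nat)
    : \bar R :=
  if i is j.+1 then ((desc_entries x)`_j)%:E else +oo%E.

Definition majorizes (R : realType) (d : nat) (u w : 'rV[R]_d) :=
  \sum_i u 0 i = \sum_i w 0 i /\
  forall j, (j < d)%N ->
    \sum_(0 <= i < j) (desc_entries w)`_i <=
    \sum_(0 <= i < j) (desc_entries u)`_i.

Definition psdmx (R : realType) (d : nat) (M : 'M[R]_d) :=
  M^T = M /\ forall v : 'rV[R]_d, 0 <= (v *m M *m v^T) 0 0.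

(* The eigenvalues with multiplicity, in nonincreasing order.  For symmetric M
   the set is a singleton by the spectral theorem; the default value 0 is only
   reached when the characteristic polynomial of M does not split over R. *)
Definition eigenvalues (R : realType) (d : nat) (M : 'M[R]_d) : 'rV[R]_d :=
  xget 0 [set l | nonincreasing_vec l /\
                  char_poly M = \prod_(i < d) ('X - (l 0 i)%:P)].

Definition f_fun (R : realType) (phi : R -> R) (d s : nat) (xi : 'rV[R]_d)
    : \bar R :=
  (\sum_(i < d | (i < s)%N) ext_pos phi (xi 0%R i))%E.

(* The values over which g_fun is the minimum. *)
Definition g_values (R : realType) (phi : R -> R) (d s : nat) (l : 'rV[R]_d)
    : set \bar R :=
  [set f_fun phi s xi | xi in
    [set xi | [/\ nonneg_vec xi, majorizes xi l & nonincreasing_vec xi]]].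

Definition g_fun (R : realType) (phi : R -> R) (d s : nat) (l : 'rV[R]_d)
    : \bar R :=
  ereal_inf (g_values phi s l).

(* (x_[k+1] + ... + x_[d]) / (s - k), used for k < s. *)
Definition tail_avg (R : realType) (d s : nat) (x : 'rV[R]_d) (k : nat) : R :=
  (\sum_(k <= i < d) (desc_entries x)`_i) / (s - k)%N%:R.

(* For a nonnegative l and 0 < s <= d exactly one k qualifies, so that the
   None branch is unreachable. *)
Definition h_fun (R : realType) (phi : R -> R) (d s : nat) (l : 'rV[R]_d)
    : \bar R :=
  if [pick k : 'I_s | ((tail_avg s l k)%:E < nth_largest l k)%E
                      && (nth_largest l k.+1 <= (tail_avg s l k)%:E)%E]
  is Some k then
    (\sum_(0 <= i < k) ext_pos phi (desc_entries l)`_i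
     + ((s - k)%N%:R)%:E * ext_pos phi (tail_avg s l k))%E
  else +oo%E.

Definition VDVt (R : realType) (d : nat) (V : 'M[R]_d) (x : 'rV[R]_d)
    : 'M[R]_d :=
  V *m diag_mx x *m V^T.

Definition feasible (R : realType) (d m s : nat) (A : 'M[R]_(m, d))
    (b : 'cV[R]_m) : set 'rV[R]_d :=
  [set x : 'rV[R]_d | [/\ forall i, 0 <= x 0 i <= 1,
               \sum_i x 0 i = s%:R
             & forall j, (A *m x^T) j 0 <= b j 0]].

(* Convexity of an extended-real-valued function on a convex domain; the
   library's convex_function only covers real-valued functions.  At t = 0 and
   t = 1 the convention 0 * +oo = 0 applies. *)
Definition ereal_convex_on (R : realType) (E : lmodType R) (D : set E)
    (F : E -> \bar R) :=
  convex_set (D : set (convex_lmodType E)) /\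
  forall x y (t : R), D x -> D y -> 0 <= t <= 1 ->
    (F (t *: x + (1 - t)%R *: y)%R <= t%:E * F x + (1 - t)%:E * F y)%E.

(* Main.v *)
Require Import Defs.
From HB Require Import structures.
From mathcomp Require Import all_boot all_order all_algebra.
From mathcomp Require Import all_classical all_reals all_analysis.
From mathcomp Require Import zify ring lra.

Set Implicit Arguments.
Unset Strict Implicit.
Unset Printing Implicit Defensive.

Import Order.TTheory GRing.Theory Num.Theory.
Import numFieldNormedType.Exports.

Local Open Scope classical_set_scope.
Local Open Scope ring_scope.

(** The two relaxations coincide pointwise: [g_fun] and [h_fun] agree on every
    nonnegative vector l.  Let k be the index selected by [h_fun], and let eta
    keep the k largest entries of l, spread the remaining mass evenly over the
    positions k+1, ..., s and vanish afterwards ([flattened]).  Its value is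
    h_s(l), it majorizes l, and it is optimal among the vectors majorizing l.
    Indeed, compare a competitor xi with eta through subgradients p_i of phi at
    eta_i: f_s(xi) - f_s(eta) is at least the sum of p_i (xi_i - eta_i).  The
    slopes p_i are nonpositive, nonincreasing in i and constant past k, while
    the partial sums of xi - eta are nonnegative up to k and the one at s is
    nonpositive; summation by parts shows that the sum is nonnegative
    ([flattened_minimal], [g_fun_h_fun]).

    Convexity is then inherited from the minimization that defines g_s.  By Ky
    Fan's principle the sum of the j largest eigenvalues of a symmetric M is the
    maximum over orthogonal Q of the sum of the first j diagonal entries of
    Q M Q^T, hence a maximum of linear functions of M ([ky_fan],
    [majorizes_eigenvalues]).  So if xi and xi' majorize the spectra of M and
    M', then t xi + (1 - t) xi' majorizes the spectrum of t M + (1 - t) M', and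
    convexity of phi concludes ([h_eigenvalues_convex]).

    The same description shows that the pairs (x, xi) with x feasible and xi
    majorizing the spectrum of V Diag(x) V^T form a compact set: each Ky Fan
    inequality is linear in (x, xi), hence a closed condition.  The lower
    semicontinuous function f_s attains its minimum there, and the x of a
    minimizing pair attains both minima ([h_fun_min_feasible]).

    The real spectral theorem behind Ky Fan's principle is proved by induction:
    a maximizer of the quadratic form on the unit sphere is an eigenvector, and
    a Householder reflection splits it off. *)

(** * Extended reals, closed sets and lower semicontinuity *)

Lemma continuous_sum (R : realType) (T : topologicalType) (I : Type)
    (r : seq I) (P : pred I) (F : I -> T -> R) :
  (forall i, P i -> continuous (F i)) ->
  continuous (fun x => \sum_(i <- r | P i) F i x).
Proof. by move=> cF; apply: continuous_big => //; exact: add_continuous. Qed.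

Lemma continuous_mul (R : realType) (T : topologicalType) (f g : T -> R) :
  continuous f -> continuous g -> continuous (fun x => f x * g x).
Proof. by move=> cf cg x; apply: cvgM; [exact: cf|exact: cg]. Qed.

Lemma rV_box_compact (R : realType) (n : nat) (a b : R) :
  compact [set v : 'rV[R]_n | forall i, a <= v 0 i <= b].
Proof.
have -> : [set v : 'rV[R]_n | forall i, a <= v 0 i <= b] =
    [set v : 'rV[R]_n | forall i, `[a, b]%classic (v ord0 i)].
  by apply/seteqP; split => v /= vab i; have := vab i; rewrite in_itv.
apply: (@rV_compact R n (fun=> `[a, b]%classic)) => _.
exact: segment_compact.
Qed.

Lemma closed_le_family (R : realType) (T : topologicalType) (I : Type)
    (P : I -> Prop) (F G : I -> T -> R) :
  (forall i, continuous (F i)) -> (forall i, continuous (G i)) ->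
  closed [set z | forall i, P i -> F i z <= G i z].
Proof.
move=> cF cG.
have -> : [set z | forall i, P i -> F i z <= G i z] =
    \bigcap_(i in [set i | P i]) ((fun z => G i z - F i z) @^-1` [set t | 0 <= t]).
  apply/seteqP; split => z /= zP i Pi; first by rewrite /= subr_ge0; exact: zP.
  by rewrite -subr_ge0; exact: zP.
apply: closed_bigI => i _; apply: preimage_closed; last exact: closed_ge.
by move=> z _; apply: cvgB; [exact: cG|exact: cF].
Qed.

Lemma closed_eq_fun (R : realType) (T : topologicalType) (F G : T -> R) :
  continuous F -> continuous G -> closed [set z | F z = G z].
Proof.
move=> cF cG.
have -> : [set z | F z = G z] = (fun z => G z - F z) @^-1` [set t | t = 0].
  apply/seteqP; split => z /= => [->|/eqP]; first by rewrite subrr.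
  by rewrite subr_eq0 => /eqP.
apply: preimage_closed; last exact: closed_eq.
by move=> z _; apply: cvgB; [exact: cG|exact: cF].
Qed.

Lemma ereal_inf_min (R : realType) (A : set (\bar R)) (m : \bar R) :
  A m -> (forall x, A x -> (m <= x)%E) -> ereal_inf A = m.
Proof.
move=> Am lm; apply/eqP; rewrite eq_le ereal_inf_lbound//=.
exact: le_ereal_inf_tmp.
Qed.

Lemma sume_gtNy (R : realType) (I : Type) (r : seq I) (P : pred I)
    (F : I -> \bar R) :
  (forall i, P i -> (-oo < F i)%E) -> (-oo < \sum_(i <- r | P i) F i)%E.
Proof.
move=> F0; elim/big_ind: _ => // x y.
by case: x => [x||]; case: y => [y||] // _ _; rewrite ?ltNyr.
Qed.

(** Excluding -oo is what makes the multiplication by a real distribute: the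
    terms may take the value +oo, but no oo - oo arises. *)
Lemma sume_distrr_gtNy (R : realType) (I : Type) (r : seq I) (P : pred I)
    (F : I -> \bar R) (t : R) :
  (forall i, P i -> (-oo < F i)%E) ->
  (t%:E * \sum_(i <- r | P i) F i = \sum_(i <- r | P i) t%:E * F i)%E.
Proof.
move=> F0; elim: r => [|i r IH]; first by rewrite !big_nil mule0.
rewrite !big_cons; case: ifP => // Pi; rewrite -IH muleDr//.
have := sume_gtNy r F0; have := F0 i Pi.
by case: (F i) => [x||]; case: (\sum_(j <- r | P j) F j)%E => [y||].
Qed.

(** The sublevel sets of f at its own values are nested, so they generate a
    proper filter on K.  At a cluster point p of it, f p cannot exceed any value
    f y: lower semicontinuity would give a neighbourhood of p that misses the
    sublevel set of y. *)
Lemma lsc_compact_min (R : realType) (T : topologicalType) (K : set T)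
    (f : T -> \bar R) :
  compact K -> K !=set0 -> lower_semicontinuous f ->
  exists2 z, K z & forall y, K y -> (f z <= f y)%E.
Proof.
move=> cK [z0 Kz0] lf.
pose S z := [set y | K y /\ (f y <= f z)%E].
have FF : ProperFilter (filter_from K S).
  apply: filter_from_proper; last by move=> z Kz; exists z.
  apply: filter_from_filter; first by exists z0.
  move=> z z' Kz Kz'; have [zz'|/ltW z'z] := leP (f z) (f z').
    by exists z => // y [Ky yz]; split; split=> //; exact: le_trans yz zz'.
  by exists z' => // y [Ky yz]; split; split=> //; exact: le_trans yz z'z.
have FK : filter_from K S K by exists z0 => // y [].
have [p [Kp clp]] := cK _ FF FK.
exists p => // y Ky; rewrite leNgt; apply/negP => yp.
have [a ya ap] : exists2 a : R, (f y <= a%:E)%E & (a%:E < f p)%E.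
  case: (f y) yp => [r rp||]; first by exists r.
    by case: (f p).
  case: (f p) => [r _||//]; last by exists 0; rewrite ?ltry ?leNye.
  by exists (r - 1); rewrite ?leNye// lte_fin; lra.
have [W nW Wa] := lf p a ap.
have [w [[_ wy] Ww]] := clp (S y) W (ex_intro2 _ _ y Ky (fun _ => id)) nW.
by have := lt_le_trans (Wa w Ww) (le_trans wy ya); rewrite ltxx.
Qed.

Lemma lower_semicontinuousD (R : realType) (T : topologicalType)
    (f g : T -> \bar R) :
  (forall x, -oo < f x)%E -> (forall x, -oo < g x)%E ->
  lower_semicontinuous f -> lower_semicontinuous g ->
  lower_semicontinuous (fun x => f x + g x)%E.
Proof.
move=> f0 g0 lf lg x a afg.
have [b [c [bf cg abc]]] : exists b c : R,
    [/\ (b%:E < f x)%E, (c%:E < g x)%E & a <= b + c].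
  have := f0 x; have := g0 x; move: afg.
  case: (f x) => [r||]//; case: (g x) => [q||]//.
  - rewrite -EFinD lte_fin => arq _ _.
    by exists (r - (r + q - a) / 2), (q - (r + q - a) / 2); rewrite !lte_fin; split; lra.
  - by move=> _ _ _; exists (r - 1), (a - (r - 1)); rewrite lte_fin ltry; split=> //; lra.
  - by move=> _ _ _; exists (a - (q - 1)), (q - 1); rewrite lte_fin ltry; split=> //; lra.
  - by move=> _ _ _; exists a, 0; rewrite !ltry; split=> //; lra.
have [U nU Ub] := lf x b bf; have [W nW Wc] := lg x c cg.
exists (U `&` W); first exact: filterI.
move=> y [Uy Wy]; apply: (@le_lt_trans _ _ (b + c)%:E); first by rewrite lee_fin.
by rewrite EFinD lteD// ?Ub ?Wc.
Qed.

Lemma lower_semicontinuous_sum (R : realType) (T : topologicalType) (I : Type)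
    (r : seq I) (P : pred I) (F : I -> T -> \bar R) :
  (forall i x, -oo < F i x)%E -> (forall i, lower_semicontinuous (F i)) ->
  lower_semicontinuous (fun x => \sum_(i <- r | P i) F i x)%E.
Proof.
move=> F0 lF; elim: r => [|i r IH].
  move=> x a; rewrite big_nil => a0; exists setT; first exact: filterT.
  by move=> y _; rewrite big_nil.
have [Pi|Pi] := boolP (P i); last first.
  suff -> : (fun x => \sum_(j <- i :: r | P j) F j x)%E =
            (fun x => \sum_(j <- r | P j) F j x)%E by [].
  by apply/funext => x; rewrite big_cons (negbTE Pi).
have -> : (fun x => \sum_(j <- i :: r | P j) F j x)%E =
          (fun x => F i x + \sum_(j <- r | P j) F j x)%E.
  by apply/funext => x; rewrite big_cons Pi.
by apply: lower_semicontinuousD => // x; exact: sume_gtNy.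
Qed.

Lemma lower_semicontinuous_comp (R : realType) (T U : topologicalType)
    (g : T -> U) (f : U -> \bar R) :
  continuous g -> lower_semicontinuous f -> lower_semicontinuous (f \o g).
Proof.
move=> cg lf x a /lf[W nW Wa].
by exists (g @^-1` W) => [|y Wy]; [exact: cg|exact: Wa].
Qed.

(** * The spectral theorem for real symmetric matrices *)

Lemma mx11_eq (R : pzRingType) (A B : 'M[R]_1) : A 0 0 = B 0 0 -> A = B.
Proof. by move=> AB; apply/matrixP => i j; rewrite !ord1. Qed.

Lemma mulmx_trE (R : pzRingType) (n : nat) (u v : 'rV[R]_n) :
  (u *m v^T) 0 0 = \sum_k u 0 k * v 0 k.
Proof. by rewrite mxE; apply: eq_bigr => k _; rewrite mxE. Qed.

Lemma mulmx_tr_ge0 (R : realDomainType) (n : nat) (u : 'rV[R]_n) :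
  0 <= (u *m u^T) 0 0.
Proof. by rewrite mulmx_trE sumr_ge0// => k _; rewrite -expr2 sqr_ge0. Qed.

Lemma mulmx_tr_eq0 (R : realDomainType) (n : nat) (u : 'rV[R]_n) :
  (u *m u^T) 0 0 = 0 -> u = 0.
Proof.
rewrite mulmx_trE => /eqP; rewrite psumr_eq0; last first.
  by move=> k _; rewrite -expr2 sqr_ge0.
move=> /allP u0; apply/rowP => k; apply/eqP.
have := u0 k (mem_index_enum k).
by rewrite -expr2 sqrf_eq0 !mxE.
Qed.

Lemma quad_formE (R : pzRingType) (n : nat) (M : 'M[R]_n) (v : 'rV[R]_n) :
  (v *m M *m v^T) 0 0 = \sum_k (\sum_j v 0 j * M j k) * v 0 k.
Proof. by rewrite mulmx_trE; apply: eq_bigr => k _; rewrite !mxE. Qed.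

Lemma quad_form_row (R : pzRingType) (n : nat) (M Q : 'M[R]_n) (i : 'I_n) :
  (row i Q *m M *m (row i Q)^T) 0 0 = (Q *m M *m Q^T) i i.
Proof.
rewrite -!row_mul tr_row [RHS]mxE !mxE.
by apply: eq_bigr => k _; rewrite !mxE.
Qed.

Lemma quad_form_continuous (R : realType) (n : nat) (M : 'M[R]_n) :
  continuous (fun v : 'rV[R]_n => (v *m M *m v^T) 0 0).
Proof.
have -> : (fun v : 'rV[R]_n => (v *m M *m v^T) 0 0) =
    (fun v : 'rV[R]_n => \sum_k (\sum_j v 0 j * M j k) * v 0 k).
  by apply/funext => v; rewrite quad_formE.
have cv j : continuous (fun v : 'rV[R]_n => v 0 j) by exact: coord_continuous.
apply: (@continuous_sum _ _ _ _ _ (fun k (v : 'rV[R]_n) =>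
  (\sum_j v 0 j * M j k) * v 0 k)) => k _.
apply: (@continuous_mul _ _ (fun v : 'rV[R]_n => _)) => //.
apply: (@continuous_sum _ _ _ _ _ (fun j (v : 'rV[R]_n) =>
  v 0 j * M j k)) => j _.
by apply: (@continuous_mul _ _ (fun v : 'rV[R]_n => _)) => //; exact: cst_continuous.
Qed.

(** Expanding the form at v + t w with w = v N gives 2 t |w|^2 + t^2 c >= 0 for
    every real t, where c is the value of the form at w.  For small negative t
    this forces w = 0. *)
Lemma psd_isotropic (R : realType) (n : nat) (N : 'M[R]_n) (v : 'rV[R]_n) :
  psdmx N -> (v *m N *m v^T) 0 0 = 0 -> v *m N = 0.
Proof.
move=> [sN pN] v0; apply: mulmx_tr_eq0; set w := v *m N.
have cross : (w *m N *m v^T) 0 0 = (w *m w^T) 0 0.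
  by rewrite -mulmxA -{1}sN -trmx_mul.
have add00 (A B : 'M[R]_1) : (A + B) 0 0 = A 0 0 + B 0 0 by rewrite mxE.
have scale00 a (A : 'M[R]_1) : (a *: A) 0 0 = a * A 0 0 by rewrite mxE.
set b := (w *m w^T) 0 0 in cross *; set c := (w *m N *m w^T) 0 0.
have ineq t : 0 <= t * b *+ 2 + t ^+ 2 * c.
  have := pN (v + t *: w).
  rewrite linearD/= linearZ/= !mulmxDl !mulmxDr -!scalemxAl -!scalemxAr scalerA.
  rewrite !add00 !scale00 v0 cross -/w -/b -/c.
  by congr (0 <= _); ring.
have b0 : 0 <= b by exact: mulmx_tr_ge0.
have c0 : 0 <= c by exact: pN.
apply/eqP; rewrite eq_le b0 andbT leNgt; apply/negP => bgt.
(* The minimum is at t = - b / c; adding 1 to c keeps the denominator nonzero. *)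
have := ineq (- (b / (c + 1))).
have c1 : c + 1 != 0 by apply: lt0r_neq0; lra.
have -> : - (b / (c + 1)) * b *+ 2 + (- (b / (c + 1))) ^+ 2 * c
   = - (b ^+ 2) * ((c + 2) / (c + 1) ^+ 2) by field.
rewrite mulNr oppr_ge0 leNgt => /negP; apply.
by rewrite mulr_gt0 ?exprn_gt0 ?divr_gt0 ?exprn_gt0//; lra.
Qed.

(** Let a be the maximum of the quadratic form on the unit sphere, attained at
    v.  Then a - M is positive semidefinite and vanishes at v, so v (a - M) = 0.
    The maximality of a is kept in the conclusion because it makes the
    eigenvalues come out in nonincreasing order in the spectral theorem. *)
Lemma top_eigenvector (R : realType) (n : nat) (M : 'M[R]_n.+1) :
  M^T = M ->
  exists (v : 'rV[R]_n.+1) (a : R),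
    [/\ v *m v^T = 1%:M, v *m M = a *: v &
        forall u : 'rV[R]_n.+1, (u *m M *m u^T) 0 0 <= a * (u *m u^T) 0 0].
Proof.
move=> sM.
pose q (v : 'rV[R]_n.+1) := (v *m M *m v^T) 0 0.
pose S := [set v : 'rV[R]_n.+1 | (v *m v^T) 0 0 = 1].
have Sc v : S v <-> (v *m 1%:M *m v^T) 0 0 = 1 by rewrite mulmx1.
have S0 : S !=set0.
  exists (delta_mx 0 0); rewrite /S/= trmx_delta mul_delta_mx mxE.
  by rewrite !eqxx.
have cS : compact S.
  apply: (subclosed_compact _ (@rV_box_compact R n.+1 (-1) 1)).
  - have -> : S = (fun v : 'rV[R]_n.+1 => (v *m 1%:M *m v^T) 0 0)
        @^-1` [set 1].
      by apply/seteqP; split => v; rewrite /= -Sc.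
    apply: preimage_closed; last exact: closed_eq.
    by move=> v _; exact: quad_form_continuous.
  - move=> v; rewrite /S/= mulmx_trE => v1 i; rewrite -ler_norml.
    rewrite -(@ler_pXn2r _ 2)// ?nnegrE// expr1n -v1 -normrX ger0_norm ?sqr_ge0//.
    rewrite (bigD1 i)//= expr2 lerDl sumr_ge0// => k _.
    by rewrite -expr2 sqr_ge0.
have [v /set_mem vS vmax] : exists2 v, v \in S & forall u, u \in S -> q u <= q v.
  apply: compact_EVT_max => //; apply: continuous_subspaceT.
  exact: quad_form_continuous.
have vv : v *m v^T = 1%:M by apply: mx11_eq; rewrite vS mxE.
have NM (u : 'rV[R]_n.+1) : (u *m ((q v)%:M - M) *m u^T) 0 0 =
    q v * (u *m u^T) 0 0 - q u.
  rewrite mulmxBr mulmxBl mul_mx_scalar -scalemxAl.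
  by rewrite /q; move: (u *m u^T) (u *m M *m u^T) => A B; rewrite !mxE.
suff rayleigh (u : 'rV[R]_n.+1) : q u <= q v * (u *m u^T) 0 0.
  exists v, (q v); split=> //.
  have sb : (q v *: v = v *m (q v)%:M) by rewrite mul_mx_scalar.
  apply/eqP; rewrite sb -subr_eq0 -mulmxBr -oppr_eq0 -mulmxN opprB; apply/eqP.
  apply: psd_isotropic; last by rewrite NM vS mulr1 subrr.
  split; first by rewrite linearB/= tr_scalar_mx sM.
  by move=> u; rewrite NM subr_ge0.
have [uu0|] := eqVneq ((u *m u^T) 0 0) 0.
  by rewrite /q (mulmx_tr_eq0 uu0) !mul0mx !mxE mulr0.
set c := (u *m u^T) 0 0 => c_neq0.
have c_gt0 : 0 < c by rewrite lt0r c_neq0 mulmx_tr_ge0.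
pose r := Num.sqrt c.
have r2 : r ^+ 2 = c by rewrite sqr_sqrtr// ltW.
have : q (r^-1 *: u) <= q v.
  apply: vmax; apply/mem_set.
  rewrite /S/= linearZ/= -scalemxAl -scalemxAr scalerA mxE -/c -expr2 exprVn r2.
  by rewrite mulVf.
rewrite /q linearZ/= -!scalemxAl -scalemxAr scalerA mxE -/(q u) -/(q v).
by rewrite -expr2 exprVn r2 ler_pdivrMl// mulrC.
Qed.

(** The reflection through the hyperplane orthogonal to v - e, with e the first
    basis vector, exchanges e and v; its first row is the image of e. *)
Lemma householder (R : realFieldType) (n : nat) (v : 'rV[R]_n.+1) :
  v *m v^T = 1%:M -> exists H : 'M[R]_n.+1, H *m H^T = 1%:M /\ row 0 H = v.
Proof.
move=> vv; pose e : 'rV[R]_n.+1 := delta_mx 0 0.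
have ee : e *m e^T = 1%:M.
  by rewrite trmx_delta mul_delta_mx; apply: mx11_eq; rewrite !mxE.
(* w is opaque: otherwise distributivity would be applied inside it. *)
have [w wE] : exists w, w = v - e by exists (v - e).
have [w0|w_neq0] := eqVneq ((w *m w^T) 0 0) 0.
  exists 1%:M; rewrite trmx1 mulmx1; split=> //.
  by rewrite row1 -/e; apply/esym/eqP; rewrite -subr_eq0 -wE (mulmx_tr_eq0 w0).
set q := (w *m w^T) 0 0 in w_neq0.
have wwE : w *m w^T = q%:M by apply: mx11_eq; rewrite [RHS]mxE.
have vee : v *m e^T = e *m v^T.
  by rewrite -[LHS]trmxK trmx_mul trmxK; apply: mx11_eq; rewrite mxE.
have ew : e *m w^T = (- q / 2)%:M.
  rewrite /q wE linearB/= !mulmxBl !mulmxBr vv ee vee.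
  by apply: mx11_eq; move: (e *m v^T) => A; rewrite !mxE eqxx !mulr1n; lra.
pose c := 2 / q.
exists (1%:M - c *: (w^T *m w)); split.
  have -> : (1%:M - c *: (w^T *m w))^T = 1%:M - c *: (w^T *m w).
    by rewrite linearB/= linearZ/= trmx1 trmx_mul trmxK.
  rewrite mulmxBl mul1mx mulmxBr mulmx1 -scalemxAl -scalemxAr.
  rewrite mulmxA -(mulmxA w^T) wwE mul_mx_scalar -scalemxAl !scalerA.
  have -> : c * (c * q) = c + c by rewrite /c; field.
  by rewrite scalerDl opprB addrK subrK.
rewrite rowE -/e mulmxBr mulmx1 -scalemxAr mulmxA ew mul_scalar_mx scalerA.
have -> : c * (- q / 2) = - 1 by rewrite /c; field.
by rewrite scaleN1r opprK wE addrC subrK.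
Qed.

(** In an orthonormal basis that starts with a top eigenvector, M becomes block
    diagonal, and the induction hypothesis applies to the lower block.  The
    eigenvalues of that block are values of the form of M at unit vectors, hence
    at most the top eigenvalue. *)
Lemma spectral_theorem (R : realType) (n : nat) (M : 'M[R]_n) : M^T = M ->
  exists (Q : 'M[R]_n) (l : 'rV[R]_n),
    [/\ Q *m Q^T = 1%:M, nonincreasing_vec l & M = Q^T *m diag_mx l *m Q].
Proof.
elim: n M => [|n IH] M sM.
  exists 1%:M, 0; split; first by rewrite trmx1 mulmx1.
    by case.
  by apply/matrixP; case.
have [v [a [vv vM vmax]]] := top_eigenvector sM.
have [H [HH rH]] := householder vv.
have HH' : H^T *m H = 1%:M by exact: mulmx1C.
pose M1 : 'M[R]_(1 + n) := H *m M *m H^T.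
have sM1 : M1^T = M1 by rewrite /M1 !trmx_mul trmxK sM mulmxA.
have rM1 : row 0 M1 = a *: delta_mx 0 0.
  by rewrite /M1 !row_mul rH vM -scalemxAl -rH -row_mul HH row1.
have ul : ulsubmx M1 = a%:M.
  apply: mx11_eq; have := congr1 (fun A : 'rV_(1 + n) => A 0 0) rM1.
  by rewrite !mxE !lshift0 => ->; rewrite !eqxx mulr1 mulr1n.
have ur : ursubmx M1 = 0.
  apply/rowP => j; have := congr1 (fun A : 'rV_(1 + n) => A 0 (rshift 1 j)) rM1.
  by rewrite !mxE !lshift0 => ->; rewrite mulr0.
have dl : dlsubmx M1 = 0 by rewrite -[LHS]trmxK trmx_dlsub sM1 ur trmx0.
have sM' : (drsubmx M1)^T = drsubmx M1 by rewrite trmx_drsub sM1.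
have [Q' [l' [QQ' sl' M'E]]] := IH _ sM'.
have M1E : M1 = block_mx a%:M 0 0 (drsubmx M1) by rewrite -[LHS]submxK ul ur dl.
pose B : 'M[R]_(1 + n) := block_mx 1%:M 0 0 Q'.
have BB : B *m B^T = 1%:M.
  rewrite /B tr_block_mx trmx1 !trmx0 mulmx_block !mulmx0 !mul0mx !addr0 add0r.
  by rewrite mulmx1 QQ' -scalar_mx_block.
pose l : 'rV[R]_(1 + n) := row_mx a%:M l'.
have BDB : M1 = B^T *m diag_mx l *m B.
  rewrite M1E M'E diag_mx_row /B tr_block_mx trmx1 !trmx0 !mulmx_block.
  rewrite !mulmx0 !mul0mx !addr0 !add0r mulmx1 mul1mx.
  congr block_mx; rewrite ?mul0mx//.
  by apply/matrixP => i j; rewrite !ord1 !mxE.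
(* Q is opaque: otherwise associativity would be applied inside it. *)
have [Q QE] : exists Q, Q = (B : 'M[R]_n.+1) *m H by eexists.
have QQ : Q *m Q^T = 1%:M.
  by rewrite QE trmx_mul mulmxA -(mulmxA _ H) HH mulmx1 BB.
have ME : M = Q^T *m diag_mx (l : 'rV[R]_n.+1) *m Q.
  have -> : M = H^T *m (M1 : 'M[R]_n.+1) *m H.
    by rewrite /M1 !mulmxA HH' mul1mx -mulmxA HH' mulmx1.
  by rewrite BDB QE trmx_mul !mulmxA.
have QMQ : Q *m M *m Q^T = diag_mx l.
  by rewrite ME !mulmxA QQ mul1mx -mulmxA QQ mulmx1.
have le_a i : l 0 i <= a.
  have := vmax (row i Q).
  rewrite quad_form_row.
  have -> : (row i Q *m (row i Q)^T) 0 0 = (Q *m Q^T) i i.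
    by rewrite tr_row !mxE; apply: eq_bigr => k _; rewrite !mxE.
  by rewrite QMQ QQ !mxE eqxx mulr1.
exists Q, l; split=> // i j.
case: (split_ordP (i : 'I_(1 + n))) => i' ->.
  rewrite [i']ord1 => _; have -> : l 0 (lshift n 0) = a.
    by rewrite /l row_mxEl mxE eqxx mulr1n.
  exact: le_a.
case: (split_ordP (j : 'I_(1 + n))) => j' ->; first by rewrite [j']ord1.
have lr k : l 0 (rshift 1 k) = l' 0 k by rewrite /l row_mxEr.
by rewrite !lr /= leq_add2l; exact: sl'.
Qed.

Lemma char_poly_diag (R : comNzRingType) (n : nat) (l : 'rV[R]_n) :
  char_poly (diag_mx l) = \prod_(i < n) ('X - (l 0 i)%:P).
Proof.
rewrite char_poly_trig ?diag_mx_is_trig//.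
by apply: eq_bigr => i _; rewrite mxE eqxx mulr1n.
Qed.

Lemma char_poly_orth_conj (R : comNzRingType) (n : nat) (Q D : 'M[R]_n) :
  Q *m Q^T = 1%:M -> char_poly (Q^T *m D *m Q) = char_poly D.
Proof.
move=> QQ; have QQ' : Q^T *m Q = 1%:M by exact: mulmx1C.
pose P := map_mx (@polyC R).
have PP : P _ _ Q^T *m P _ _ Q = 1%:M by rewrite -map_mxM QQ' map_mx1.
rewrite /char_poly /char_poly_mx.
have -> : 'X%:M - P _ _ (Q^T *m D *m Q) =
    P _ _ Q^T *m ('X%:M - P _ _ D) *m P _ _ Q.
  rewrite !mulmxBr mulmxBl -/P /P !map_mxM/=; congr (_ - _).
  by rewrite mul_mx_scalar -scalemxAl -/P PP scalemx1.
by rewrite !det_mulmx mulrAC -det_mulmx PP det1 mul1r.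
Qed.

Lemma nth_entries (R : nmodType) (n : nat) (u : 'rV[R]_n) (i : 'I_n) :
  [seq u 0 i | i : 'I_n]`_i = u 0 i.
Proof. by rewrite (nth_map i) ?size_enum_ord// nth_ord_enum. Qed.

Lemma sorted_entries (R : realType) (n : nat) (u : 'rV[R]_n) :
  nonincreasing_vec u -> sorted >=%R [seq u 0 i | i : 'I_n].
Proof.
move=> su; apply/(sortedP 0) => i; rewrite size_image card_ord => i1n.
rewrite (nth_entries u (Ordinal i1n)) (nth_entries u (Ordinal (ltnW i1n))).
exact: su.
Qed.

(** The characteristic polynomial determines the multiset of its roots, and a
    multiset has a single nonincreasing arrangement; so any orthogonal
    diagonalization computes [eigenvalues]. *)
Lemma eigenvaluesE (R : realType) (n : nat) (Q : 'M[R]_n) (l : 'rV[R]_n) :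
  Q *m Q^T = 1%:M -> nonincreasing_vec l ->
  eigenvalues (Q^T *m diag_mx l *m Q) = l.
Proof.
move=> QQ sl; rewrite /eigenvalues char_poly_orth_conj// char_poly_diag.
apply: xget_unique => // l' [sl' ll'].
have : perm_eq [seq l' 0 i | i : 'I_n] [seq l 0 i | i : 'I_n].
  apply: prod_XsubC_eq; rewrite !big_image/= .
  by rewrite -ll'.
move/(sorted_eq ge_trans ge_anti (sorted_entries sl') (sorted_entries sl)) => eq_s.
by apply/rowP => i; rewrite -!nth_entries eq_s.
Qed.

Lemma eigenvalues_spectral (R : realType) (n : nat) (M : 'M[R]_n) : M^T = M ->
  exists Q : 'M[R]_n, [/\ Q *m Q^T = 1%:M,
    nonincreasing_vec (eigenvalues M) & Q *m M *m Q^T = diag_mx (eigenvalues M)].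
Proof.
move=> sM; have [Q [l [QQ sl ME]]] := spectral_theorem sM.
have -> : eigenvalues M = l by rewrite ME eigenvaluesE.
exists Q; split=> //.
by rewrite ME !mulmxA QQ mul1mx -mulmxA QQ mulmx1.
Qed.

Lemma trace_eigenvalues (R : realType) (n : nat) (M : 'M[R]_n) : M^T = M ->
  \sum_i eigenvalues M 0 i = \tr M.
Proof.
move=> sM; have [Q [QQ _ QMQ]] := eigenvalues_spectral sM.
by rewrite -mxtrace_diag -QMQ -mulmxA mxtrace_mulC -mulmxA (mulmx1C QQ) mulmx1.
Qed.

Lemma sum_first_ord (R : pzSemiRingType) (n j : nat) : (j <= n)%N ->
  \sum_(i < n | (i < j)%N) 1 = j%:R :> R.
Proof.
by move=> jn; rewrite -(big_ord_widen n (fun=> 1) jn) sumr_const card_ord.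
Qed.

(** Weights in [0, 1] of total mass j collect the most from a nonincreasing l by
    saturating its first j entries.  With a threshold th between the j-th and the
    next entry, the difference of the two sides is the sum of the nonnegative
    terms ([i < j] - w_i) (l_i - th). *)
Lemma bathtub_bound (R : realType) (n j : nat) (w l : 'rV[R]_n) :
  nonincreasing_vec l -> (j <= n)%N -> (forall i, 0 <= w 0 i <= 1) ->
  \sum_i w 0 i = j%:R ->
  \sum_i w 0 i * l 0 i <= \sum_(i < n | (i < j)%N) l 0 i.
Proof.
move=> sl jn w01 wj.
have [th thP] : exists th, forall i : 'I_n,
    (if (i < j)%N then th <= l 0 i else l 0 i <= th).
  case: n j w l sl jn w01 wj => [|n] j w l sl jn w01 wj.
    by exists 0; case.
  exists (l 0 (inord j.-1)) => i; have [ij|ji] := ltnP i j.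
    by apply: sl; rewrite inordK; lia.
  by apply: sl; rewrite inordK; have := ltn_ord i; lia.
rewrite -subr_ge0.
have -> : \sum_(i < n | (i < j)%N) l 0 i - \sum_i w 0 i * l 0 i =
    \sum_(i < n) ((i < j)%N%:R - w 0 i) * (l 0 i - th).
  under [RHS]eq_bigr do rewrite mulrBr !mulrBl.
  have jE : \sum_(i < n) (i < j)%N%:R = j%:R :> R.
    rewrite -(sum_first_ord R jn) [RHS]big_mkcond.
    by apply: eq_bigr => i _; case: ltnP.
  rewrite !sumrB -!mulr_suml wj jE subrr subr0; congr (_ - _).
  rewrite big_mkcond; apply: eq_bigr => i _.
  by case: ltnP; rewrite ?mul1r ?mul0r.
apply: sumr_ge0 => i _; have := thP i; have /andP[w0 w1] := w01 i.
case: ltnP => _ li; first by rewrite mulr_ge0// subr_ge0.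
by rewrite mulr_le0// ?subr_le0// sub0r oppr_le0.
Qed.

Lemma orth_row_sqsum (R : realFieldType) (n : nat) (T : 'M[R]_n) :
  T *m T^T = 1%:M -> forall k, \sum_i (T k i) ^+ 2 = 1.
Proof.
move=> TT k; have := congr1 (fun A : 'M[R]_n => A k k) TT.
by rewrite !mxE eqxx mulr1n => <-; apply: eq_bigr => i _; rewrite mxE expr2.
Qed.

(** In an eigenbasis the diagonal entry i of Q M Q^T is the average of the
    eigenvalues with weights T_ik^2, where T is orthogonal.  Summing over i < j
    gives each eigenvalue a weight at most 1 (columns of T have norm 1), of total
    mass j (rows of T have norm 1), so [bathtub_bound] applies. *)
Lemma ky_fan (R : realType) (n j : nat) (M Q : 'M[R]_n) :
  M^T = M -> Q *m Q^T = 1%:M -> (j <= n)%N ->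
  \sum_(i < n | (i < j)%N) (Q *m M *m Q^T) i i <=
  \sum_(i < n | (i < j)%N) eigenvalues M 0 i.
Proof.
move=> sM QQ jn; have [P [PP sl PMP]] := eigenvalues_spectral sM.
set l := eigenvalues M in sl PMP *.
pose T := Q *m P^T.
have PP' : P^T *m P = 1%:M by exact: mulmx1C.
have TT : T *m T^T = 1%:M.
  by rewrite /T trmx_mul trmxK mulmxA -(mulmxA Q) PP' mulmx1.
have TT' : T^T *m (T^T)^T = 1%:M by rewrite trmxK; exact: mulmx1C.
have QMQ : Q *m M *m Q^T = T *m diag_mx l *m T^T.
  rewrite -PMP /T trmx_mul trmxK !mulmxA -(mulmxA Q P^T P) PP' mulmx1.
  by rewrite -(mulmxA _ P^T) PP' mulmx1.
have diagE i : (Q *m M *m Q^T) i i = \sum_k (T i k) ^+ 2 * l 0 k.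
  rewrite QMQ mul_mx_diag mxE; apply: eq_bigr => k _.
  by rewrite !mxE mulrAC expr2.
under eq_bigr do rewrite diagE.
rewrite exchange_big /=.
pose w : 'rV[R]_n := \row_k \sum_(i < n | (i < j)%N) (T i k) ^+ 2.
have -> : \sum_(k < n) \sum_(i < n | (i < j)%N) (T i k) ^+ 2 * l 0 k =
    \sum_k w 0 k * l 0 k.
  by apply: eq_bigr => k _; rewrite mxE mulr_suml.
apply: bathtub_bound => // [k|].
  rewrite mxE sumr_ge0/=; last by move=> i _; exact: sqr_ge0.
  have <- := orth_row_sqsum TT' k.
  under [leRHS]eq_bigr do rewrite mxE.
  rewrite [leRHS](bigID (fun i : 'I_n => (i < j)%N)) /= lerDl sumr_ge0// => i _.
  exact: sqr_ge0.
under eq_bigr do rewrite mxE.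
rewrite exchange_big /=.
under eq_bigr do rewrite orth_row_sqsum//.
by rewrite sum_first_ord.
Qed.

(** * Decreasing rearrangements and the separable objective *)

Lemma size_desc_entries (R : realType) (d : nat) (l : 'rV[R]_d) :
  size (desc_entries l) = d.
Proof. by rewrite /desc_entries size_sort size_image card_ord. Qed.

Lemma desc_entries_ge0 (R : realType) (d : nat) (l : 'rV[R]_d) (i : nat) :
  nonneg_vec l -> 0 <= (desc_entries l)`_i.
Proof.
move=> l0; have [id|di] := ltnP i d; last first.
  by rewrite nth_default// size_desc_entries.
have : (desc_entries l)`_i \in desc_entries l.
  by rewrite mem_nth// size_desc_entries.
by rewrite /desc_entries mem_sort => /fintype.imageP[j _ ->].
Qed.

Lemma desc_entries_nonincr (R : realType) (d : nat) (l : 'rV[R]_d) (i j : nat) :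
  nonneg_vec l -> (i <= j)%N -> (desc_entries l)`_j <= (desc_entries l)`_i.
Proof.
move=> l0 ij; have [jd|dj] := ltnP j d; last first.
  rewrite [leLHS]nth_default ?size_desc_entries//.
  exact: desc_entries_ge0.
have srt : sorted >=%R (desc_entries l).
  by apply: sort_sorted => x y; exact: le_total.
apply: (sorted_leq_nth ge_trans ge_refl 0 srt) => //.
  by rewrite inE size_desc_entries; exact: leq_ltn_trans jd.
by rewrite inE size_desc_entries.
Qed.

Lemma sum_desc_entries (R : realType) (d : nat) (l : 'rV[R]_d) :
  \sum_(0 <= i < d) (desc_entries l)`_i = \sum_i l 0 i.
Proof.
rewrite -{1}(size_desc_entries l) -(big_nth 0 xpredT idfun) /=.
by rewrite /desc_entries (perm_big _ (permEl (perm_sort _ _))) /= big_image.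
Qed.

Lemma desc_entriesE (R : realType) (d : nat) (l : 'rV[R]_d) (i : 'I_d) :
  nonincreasing_vec l -> (desc_entries l)`_i = l 0 i.
Proof.
move=> sl; rewrite /desc_entries (sorted_sort ge_trans (sorted_entries sl)).
exact: nth_entries.
Qed.

Lemma sum_desc_entriesE (R : realType) (d j : nat) (l : 'rV[R]_d) :
  nonincreasing_vec l -> (j <= d)%N ->
  \sum_(0 <= i < j) (desc_entries l)`_i = \sum_(i < d | (i < j)%N) l 0 i.
Proof.
move=> sl jd; rewrite big_mkord (big_ord_widen d _ jd).
by apply: eq_bigr => i _; rewrite desc_entriesE.
Qed.

Lemma f_funE (R : realType) (phi : R -> R) (d s : nat) (xi : 'rV[R]_d) :
  nonincreasing_vec xi -> (s <= d)%N ->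
  f_fun phi s xi = (\sum_(0 <= i < s) ext_pos phi (desc_entries xi)`_i)%E.
Proof.
move=> sxi sd; rewrite big_mkord.
rewrite (big_ord_widen d (fun i => ext_pos phi (desc_entries xi)`_i) sd).
by apply: eq_bigr => i _; rewrite desc_entriesE.
Qed.

Lemma convex_function_ineq (R : realType) (phi : R -> R) (t u v : R) :
  convex_function [set t : R^o | 0 < t] phi ->
  0 < u -> 0 < v -> 0 <= t <= 1 ->
  phi (t * u + (1 - t) * v) <= t * phi u + (1 - t) * phi v.
Proof.
move=> cphi u0 v0 /andP[t0 t1].
exact: (cphi (Itv01 t0 t1) u v (mem_set u0) (mem_set v0)).
Qed.

Lemma chord_slope (R : realType) (phi : R -> R) (u a v : R) :
  convex_function [set t : R^o | 0 < t] phi ->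
  0 < u -> u < a -> a < v ->
  (phi a - phi u) / (a - u) <= (phi v - phi a) / (v - a).
Proof.
move=> cphi u0 ua av.
rewrite ler_pdivrMr ?subr_gt0// mulrAC ler_pdivlMr ?subr_gt0//.
have vu : 0 < v - u by lra.
pose t := (v - a) / (v - u).
have t01 : 0 <= t <= 1.
  by rewrite divr_ge0 ?ler_pdivrMr//; lra.
have := @convex_function_ineq R phi t u v cphi u0 (lt_trans u0 (lt_trans ua av)) t01.
have -> : t * u + (1 - t) * v = a by rewrite /t; field; rewrite lt0r_neq0.
have -> : t * phi u + (1 - t) * phi v =
    ((v - a) * phi u + (a - u) * phi v) / (v - u).
  by rewrite /t; field; rewrite lt0r_neq0.
rewrite ler_pdivlMr//; nra.
Qed.

(** At a > 0 the slope is the supremum of the slopes of the chords that end at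
    a; [chord_slope] bounds them by every slope of a chord starting at a. *)
Lemma subgradient (R : realType) (phi : R -> R) :
  convex_function [set t : R^o | 0 < t] phi ->
  exists p : R -> R, forall a u, 0 < a -> 0 < u ->
    p a * (u - a) <= phi u - phi a.
Proof.
move=> cphi.
suff /choice[p pP] : forall a : R, exists p : R, forall u, 0 < a -> 0 < u ->
    p * (u - a) <= phi u - phi a by exists p => a u; exact: pP.
move=> a; have [a0|] := ltP 0 a; last by exists 0.
pose S := [set (phi a - phi u) / (a - u) | u in [set u | 0 < u < a]].
have S0 : S !=set0.
  by exists ((phi a - phi (a / 2)) / (a - a / 2)), (a / 2) => //=; lra.
have ubS v : a < v -> ubound S ((phi v - phi a) / (v - a)).
  by move=> av _ [u /andP[u0 ua] <-]; exact: chord_slope.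
have hS : has_sup S.
  by split=> //; exists ((phi (a + 1) - phi a) / (a + 1 - a)); apply: ubS; lra.
exists (sup S) => u _ u0; have [ua|au|->] := ltgtP u a; last by lra.
  have : (phi a - phi u) / (a - u) <= sup S.
    by apply: ub_le_sup; [exact: hS.2|exists u => //=; rewrite u0 ua].
  by rewrite ler_pdivrMr ?subr_gt0//; lra.
have : sup S <= (phi u - phi a) / (u - a) by apply: ge_sup => //; exact: ubS.
by rewrite ler_pdivlMr ?subr_gt0.
Qed.

Lemma subgradient_nondecr (R : realFieldType) (phi p : R -> R) :
  (forall a u, 0 < a -> 0 < u -> p a * (u - a) <= phi u - phi a) ->
  forall a u, 0 < a -> a <= u -> p a <= p u.
Proof.
move=> pP a u a0; rewrite le_eqVlt => /predU1P[->//|au].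
have u0 := lt_trans a0 au.
have := lerD (pP a u a0 u0) (pP u a u0 a0).
rewrite -subr_ge0 => H; rewrite -subr_ge0 -(pmulr_lge0 _ (_ : 0 < u - a)) ?subr_gt0//.
lra.
Qed.

Lemma ext_pos_gtNy (R : realType) (phi : R -> R) (t : R) :
  (-oo < ext_pos phi t)%E.
Proof. by rewrite /ext_pos; case: ifP => _; rewrite ?ltNyr. Qed.

Lemma sum_ext_posE (R : realType) (phi : R -> R) (c : nat -> R) (s : nat) :
  (forall i, (i < s)%N -> 0 < c i) ->
  (\sum_(0 <= i < s) ext_pos phi (c i))%E = (\sum_(0 <= i < s) phi (c i))%:E.
Proof.
move=> c0; rewrite -sumEFin; apply: eq_big_nat => i /andP[_ /c0 ci].
by rewrite /ext_pos ci.
Qed.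

Lemma sum_ext_pos_pinfty (R : realType) (phi : R -> R) (c : nat -> R)
    (s i : nat) :
  (i < s)%N -> c i <= 0 -> (\sum_(0 <= i < s) ext_pos phi (c i))%E = +oo%E.
Proof.
move=> si ci; rewrite big_mkord; apply/eqP; rewrite esum_eqy.
  apply/existsP; exists (Ordinal si) => /=.
  by rewrite /ext_pos ltNge ci eqxx.
by move=> j _; rewrite gt_eqF// ext_pos_gtNy.
Qed.

(** Summation by parts: with nonincreasing q and nonnegative partial sums of z,
    replacing each q_i by the final value q_k can only decrease the sum. *)
Lemma abel_lower_bound (R : realFieldType) (q z : nat -> R) (k : nat) :
  (forall i, (i < k)%N -> q i.+1 <= q i) ->
  (forall j, (j <= k)%N -> 0 <= \sum_(0 <= i < j) z i) ->
  q k * \sum_(0 <= i < k) z i <= \sum_(0 <= i < k) q i * z i.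
Proof.
elim: k => [|k IH] qd z0; first by rewrite !big_nil mulr0.
rewrite [leRHS]big_nat_recr//=.
have := IH (fun i ik => qd i (ltnW ik)) (fun j jk => z0 j (leqW jk)).
have := z0 k.+1 (leqnn _); have := qd k (leqnn _).
rewrite !(big_nat_recr k)//=; set Z := \sum_(0 <= i < k) z i; nra.
Qed.

(** * The optimal majorizing vector *)

(** The least k whose entry lies below the average of the tail works: such k
    exist because s - 1 is one of them, the average there being the whole tail
    sum.  At a positive k, the failure at k - 1 says that the entry at k - 1
    exceeds an average to which it contributes, hence also the average without
    it. *)
Lemma flat_index_exists (R : realType) (d s : nat) (l : 'rV[R]_d) :
  nonneg_vec l -> (0 < s)%N -> (s <= d)%N ->
  exists k : 'I_s, (k = 0%N :> nat \/ tail_avg s l k < (desc_entries l)`_k.-1) /\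
    (desc_entries l)`_k <= tail_avg s l k.
Proof.
move=> l0 s0 sd; set e := fun i => (desc_entries l)`_i.
have e0 i : 0 <= e i by exact: desc_entries_ge0.
pose P k := (k < s)%N && (e k <= tail_avg s l k).
have exP : exists k, P k.
  exists s.-1; rewrite /P prednK// leqnn /= /tail_avg.
  have -> : (s - s.-1 = 1)%N by lia.
  rewrite divr1 big_ltn; last by lia.
  by rewrite lerDl sumr_ge0.
case: (ex_minnP exP) => k /andP[ks ek] kmin.
exists (Ordinal ks); split=> //=; have [->|k_neq0] := eqVneq k 0%N; [by left|right].
have : ~~ P k.-1 by apply/negP => /kmin; lia.
rewrite /P negb_and -leqNgt -ltNge => /orP[|]; first by lia.
rewrite /tail_avg (big_ltn (m := k.-1)); last by lia.
rewrite prednK ?lt0n// -/(e k.-1) -/(e _).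
set T := \sum_(k <= i < d) _.
have -> : ((s - k.-1)%N = (s - k).+1) by lia.
have sk : 0 < (s - k)%N%:R :> R by rewrite ltr0n subn_gt0.
rewrite !ltr_pdivrMr ?ltr0Sn// -natr1 mulrDr mulr1; lra.
Qed.

(** The optimal solution of the problem defining [g_fun], extended by zero to
    all natural indices like the entries of [desc_entries]. *)
Definition flattened (R : realType) (d s : nat) (l : 'rV[R]_d) (k i : nat) : R :=
  if (i < k)%N then (desc_entries l)`_i
  else if (i < s)%N then tail_avg s l k else 0.

(** The defining property of k in [h_fun], with the strict inequality weakened
    and extended to all earlier entries. *)
Definition flat_spec (R : realType) (d s : nat) (l : 'rV[R]_d) (k : nat) :=
  [/\ (k < s)%N, (forall j, (j < k)%N -> tail_avg s l k <= (desc_entries l)`_j) &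
    (desc_entries l)`_k <= tail_avg s l k].

Lemma sum_flattened_head (R : realType) (d s : nat) (l : 'rV[R]_d) (k j : nat) :
  (j <= k)%N ->
  \sum_(0 <= i < j) flattened s l k i = \sum_(0 <= i < j) (desc_entries l)`_i.
Proof.
move=> jk; apply: eq_big_nat => i /andP[_ ij].
by rewrite /flattened (leq_trans ij jk).
Qed.

Lemma sum_flattened_plateau (R : realType) (d s : nat) (l : 'rV[R]_d) (k j : nat) :
  (k <= j <= s)%N ->
  \sum_(k <= i < j) flattened s l k i = tail_avg s l k *+ (j - k).
Proof.
move=> /andP[kj js]; rewrite -[RHS]sumr_const_nat; apply: eq_big_nat => i /andP[ki ij].
by rewrite /flattened ltnNge ki /= (leq_trans ij js).
Qed.

Lemma tail_avgMn (R : realType) (d s : nat) (l : 'rV[R]_d) (k : nat) :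
  (k < s)%N ->
  tail_avg s l k *+ (s - k) = \sum_(k <= i < d) (desc_entries l)`_i.
Proof.
move=> ks; rewrite -mulr_natr /tail_avg divfK// pnatr_eq0; lia.
Qed.

Lemma sum_flattened_total (R : realType) (d s : nat) (l : 'rV[R]_d) (k j : nat) :
  (k < s)%N -> (s <= j)%N -> (s <= d)%N ->
  \sum_(0 <= i < j) flattened s l k i = \sum_(0 <= i < d) (desc_entries l)`_i.
Proof.
move=> ks sj sd.
have hi0 : \sum_(s <= i < j) flattened s l k i = 0.
  rewrite big_nat big1// => i /andP[si _]; rewrite /flattened.
  by rewrite !ltnNge si (leq_trans (ltnW ks) si).
rewrite (@big_cat_nat _ _ _ s)//= hi0 addr0.
rewrite (@big_cat_nat _ _ _ k)//=; last exact: ltnW.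
rewrite sum_flattened_head// sum_flattened_plateau ?leqnn ?andbT 1?ltnW// tail_avgMn//.
by rewrite -big_cat_nat//; lia.
Qed.

Lemma flattened_ge0 (R : realType) (d s : nat) (l : 'rV[R]_d) (k i : nat) :
  nonneg_vec l -> 0 <= flattened s l k i.
Proof.
move=> l0; rewrite /flattened; case: ifP => _; first exact: desc_entries_ge0.
case: ifP => // _; rewrite divr_ge0// sumr_ge0// => j _.
exact: desc_entries_ge0.
Qed.

Lemma flattened_nonincr (R : realType) (d s : nat) (l : 'rV[R]_d) (k i j : nat) :
  nonneg_vec l -> flat_spec s l k -> (i <= j)%N ->
  flattened s l k j <= flattened s l k i.
Proof.
move=> l0 [ks hi lo] ij; have := flattened_ge0 s k i l0.
rewrite /flattened; have [jk|kj] := ltnP j k.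
  by rewrite (leq_ltn_trans ij jk) => _; exact: desc_entries_nonincr.
have [ik|ki] := ltnP i k; case: (ltnP j s) => js //; first by move=> _; exact: hi.
by rewrite (leq_ltn_trans ij js).
Qed.

Lemma flattened_majorizes (R : realType) (d s : nat) (l : 'rV[R]_d) (k j : nat) :
  nonneg_vec l -> flat_spec s l k -> (s <= d)%N -> (j <= d)%N ->
  \sum_(0 <= i < j) (desc_entries l)`_i <= \sum_(0 <= i < j) flattened s l k i.
Proof.
move=> l0 [ks hi lo] sd jd.
have [jk|kj] := leqP j k; first by rewrite sum_flattened_head.
have [js|sj] := leqP j s; last first.
  rewrite (sum_flattened_total _ ks (ltnW sj) sd).
  rewrite [leRHS](@big_cat_nat _ _ _ j)//= lerDl sumr_ge0// => i _.
  exact: desc_entries_ge0.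
rewrite !(@big_cat_nat _ _ _ k 0 j)//= ?(ltnW kj)//.
rewrite sum_flattened_head// lerD2l big_nat [leRHS]big_nat.
apply: ler_sum => i /andP[ki ij].
rewrite /flattened ltnNge ki /= (leq_trans ij js).
exact: le_trans (desc_entries_nonincr l0 ki) lo.
Qed.

Lemma sum_ext_pos_flattened (R : realType) (phi : R -> R) (d s : nat)
    (l : 'rV[R]_d) (k : nat) : (k < s)%N ->
  (\sum_(0 <= i < s) ext_pos phi (flattened s l k i) =
   \sum_(0 <= i < k) ext_pos phi (desc_entries l)`_i
     + ((s - k)%N%:R)%:E * ext_pos phi (tail_avg s l k))%E.
Proof.
move=> ks; rewrite (@big_cat_nat _ _ _ k)//=; last exact: ltnW.
congr (_ + _)%E.
  by apply: eq_big_nat => i /andP[_ ik]; rewrite /flattened ik.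
rewrite (eq_big_nat _ _ (F2 := fun=> ext_pos phi (tail_avg s l k))); last first.
  by move=> i /andP[ki si]; rewrite /flattened ltnNge ki si.
rewrite big_const_nat mule_natl; elim: (s - k)%N => [|n IH] //.
by rewrite iterS IH muleS.
Qed.

(** The value +oo that [h_fun] takes when no index qualifies is excluded by
    [flat_index_exists]. *)
Lemma h_fun_flattened (R : realType) (phi : R -> R) (d s : nat) (l : 'rV[R]_d) :
  nonneg_vec l -> (0 < s)%N -> (s <= d)%N ->
  exists2 k, flat_spec s l k &
    h_fun phi s l = (\sum_(0 <= i < s) ext_pos phi (flattened s l k i))%E.
Proof.
move=> l0 s0 sd; rewrite /h_fun.
case: pickP => [k /andP[hi lo]|none]; last first.
  have [k [hi lo]] := flat_index_exists l0 s0 sd.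
  have := none k; rewrite /= lee_fin lo andbT => /negP[].
  case: hi => [->|]; first exact: ltry.
  by case: (k : nat) => [|k'] /=; rewrite ?ltry ?lte_fin.
exists k; last by rewrite sum_ext_pos_flattened.
split=> // j jk; case: (k : nat) hi jk => // k' /=; rewrite lte_fin => /ltW hi jk.
by apply: (le_trans hi); exact: desc_entries_nonincr.
Qed.

(** The comparison by subgradients and summation by parts.  It says nothing when
    the plateau is at height 0, where phi has no subgradient; then the total mass
    leaves nothing for the entries of c in the range k <= i < s, so that both
    sides are infinite. *)
Lemma flattened_minimal (R : realType) (phi : R -> R) (d s : nat)
    (l : 'rV[R]_d) (k : nat) (c : nat -> R) :
  convex_function [set t : R^o | 0 < t] phi ->
  (forall t u : R, 0 < t -> t <= u -> phi u <= phi t) ->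
  (s <= d)%N -> nonneg_vec l -> flat_spec s l k -> (forall i, 0 <= c i) ->
  (forall j, (j < d)%N ->
    \sum_(0 <= i < j) (desc_entries l)`_i <= \sum_(0 <= i < j) c i) ->
  \sum_(0 <= i < s) c i <= \sum_(0 <= i < d) (desc_entries l)`_i ->
  (\sum_(0 <= i < s) ext_pos phi (flattened s l k i) <=
   \sum_(0 <= i < s) ext_pos phi (c i))%E.
Proof.
move=> cphi nphi sd l0 fs c0 maj tot; have [ks hi lo] := fs.
set x := flattened s l k.
have kd : (k < d)%N by exact: leq_trans ks sd.
have Dlo j : (j <= k)%N -> 0 <= \sum_(0 <= i < j) (c i - x i).
  by move=> jk; rewrite sumrB sum_flattened_head// subr_ge0 maj; lia.
have Dtot : \sum_(0 <= i < s) (c i - x i) <= 0.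
  by rewrite sumrB (sum_flattened_total _ ks (leqnn _) sd) subr_le0.
have splitk (F : nat -> R) : \sum_(0 <= i < s) F i =
    \sum_(0 <= i < k) F i + \sum_(k <= i < s) F i.
  by rewrite (@big_cat_nat _ _ _ k)//= ltnW.
have xmid i : (k <= i < s)%N -> x i = tail_avg s l k.
  by move=> /andP[ki si]; rewrite /x /flattened ltnNge ki si.
have [a_gt0|a_le0] := ltP 0 (tail_avg s l k); last first.
  rewrite (@sum_ext_pos_pinfty _ phi c s k)// ?leey//.
  have : \sum_(k <= i < s) (c i - x i) <= 0.
    by move: Dtot; rewrite splitk; have := Dlo k (leqnn k); lra.
  rewrite sumrB subr_le0 sum_flattened_plateau ?leqnn ?andbT 1?ltnW// => le_a.
  have : \sum_(k <= i < s) c i <= 0.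
    by apply: le_trans le_a _; rewrite -oppr_ge0 -mulNrn mulrn_wge0 ?oppr_ge0.
  by rewrite big_ltn//; apply: le_trans; rewrite lerDl sumr_ge0.
have [cpos|/existsNP[i /not_implyP[si /negP]]] :=
    pselect (forall i, (i < s)%N -> 0 < c i); last first.
  by rewrite -leNgt => ci; rewrite (sum_ext_pos_pinfty phi si ci) leey.
have xpos i : (i < s)%N -> 0 < x i.
  move=> si; have [ki|ik] := leqP k i; first by rewrite xmid// ki.
  by rewrite /x /flattened ik; exact: lt_le_trans a_gt0 (hi _ ik).
rewrite !sum_ext_posE// lee_fin -subr_ge0 -sumrB.
have [p pP] := subgradient cphi.
have pmono := subgradient_nondecr pP.
have p_le0 a : 0 < a -> p a <= 0.
  move=> a0; have := pP a (a + 1) a0.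
  by have := nphi a (a + 1) a0; lra.
apply: (@le_trans _ _ (\sum_(0 <= i < s) p (x i) * (c i - x i))); last first.
  rewrite big_nat [leRHS]big_nat; apply: ler_sum => i /andP[_ si].
  by apply: pP; [exact: xpos|exact: cpos].
rewrite splitk [X in _ + X](_ : _ =
    p (x k) * \sum_(k <= i < s) (c i - x i)); last first.
  rewrite mulr_sumr; apply: eq_big_nat => i kis.
  by rewrite !xmid// ?leqnn.
apply: (@le_trans _ _ (p (x k) * \sum_(0 <= i < s) (c i - x i))).
  by rewrite mulr_le0//; apply: p_le0; exact: xpos.
rewrite splitk mulrDr lerD2r.
apply: (@abel_lower_bound _ (p \o x)) => // i ik /=.
apply: pmono; first by apply: xpos; lia.
by apply: flattened_nonincr.
Qed.

Definition admissible (R : realType) (d : nat) (l xi : 'rV[R]_d) :=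
  [/\ nonneg_vec xi, majorizes xi l & nonincreasing_vec xi].

Lemma h_fun_le (R : realType) (phi : R -> R) (d s : nat) (l xi : 'rV[R]_d) :
  convex_function [set t : R^o | 0 < t] phi ->
  (forall t u : R, 0 < t -> t <= u -> phi u <= phi t) ->
  (0 < s)%N -> (s <= d)%N -> nonneg_vec l -> admissible l xi ->
  (h_fun phi s l <= f_fun phi s xi)%E.
Proof.
move=> cphi nphi s0 sd l0 [xi0 [tot maj] sxi].
have [k fs ->] := h_fun_flattened phi l0 s0 sd; rewrite f_funE//.
apply: flattened_minimal => // [i|]; first exact: desc_entries_ge0.
rewrite sum_desc_entries -tot -sum_desc_entries.
rewrite [leRHS](@big_cat_nat _ _ _ s)//= lerDl sumr_ge0// => i _.
exact: desc_entries_ge0.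
Qed.

Lemma h_fun_attained (R : realType) (phi : R -> R) (d s : nat) (l : 'rV[R]_d) :
  (0 < s)%N -> (s <= d)%N -> nonneg_vec l ->
  exists2 xi, admissible l xi & f_fun phi s xi = h_fun phi s l.
Proof.
move=> s0 sd l0; have [k fs ->] := h_fun_flattened phi l0 s0 sd.
pose xi : 'rV[R]_d := \row_i flattened s l k i.
have sxi : nonincreasing_vec xi.
  by move=> i j ij; rewrite !mxE; exact: flattened_nonincr.
have xiE i : (i < d)%N -> (desc_entries xi)`_i = flattened s l k i.
  by move=> id; rewrite (desc_entriesE (Ordinal id) sxi) mxE.
exists xi; last first.
  rewrite f_funE//; apply: eq_big_nat => i /andP[_ si].
  by rewrite xiE//; exact: leq_trans si sd.
split=> //; first by move=> i; rewrite mxE; exact: flattened_ge0.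
have sumE j : (j <= d)%N -> \sum_(0 <= i < j) (desc_entries xi)`_i =
    \sum_(0 <= i < j) flattened s l k i.
  move=> jd; apply: eq_big_nat => i /andP[_ ij].
  by rewrite xiE//; exact: leq_trans ij jd.
split; last by move=> j jd; rewrite sumE 1?ltnW// flattened_majorizes// ltnW.
have [ks _ _] := fs.
by rewrite -!sum_desc_entries sumE// (sum_flattened_total _ ks).
Qed.

Lemma g_fun_h_fun (R : realType) (phi : R -> R) (d s : nat) (l : 'rV[R]_d) :
  convex_function [set t : R^o | 0 < t] phi ->
  (forall t u : R, 0 < t -> t <= u -> phi u <= phi t) ->
  (0 < s)%N -> (s <= d)%N -> nonneg_vec l -> g_fun phi s l = h_fun phi s l.
Proof.
move=> cphi nphi s0 sd l0; apply: ereal_inf_min.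
  by have [xi adm <-] := h_fun_attained phi s0 sd l0; exists xi.
by move=> _ [xi adm <-]; exact: h_fun_le.
Qed.

(** * Convexity of the spectral function *)

Lemma ext_pos_convex (R : realType) (phi : R -> R) (t u v : R) :
  convex_function [set t : R^o | 0 < t] phi -> 0 < t < 1 ->
  (ext_pos phi (t * u + (1 - t) * v) <=
   t%:E * ext_pos phi u + (1 - t)%:E * ext_pos phi v)%E.
Proof.
move=> cphi /andP[t0 t1]; have t1' : 0 < 1 - t by rewrite subr_gt0.
rewrite /ext_pos; case: (ltP 0 u) => u0; last first.
  rewrite gt0_muley ?lte_fin//; case: (ltP 0 v) => v0.
    by rewrite -EFinM addye ?leey.
  by rewrite gt0_muley ?lte_fin// leey.
case: (ltP 0 v) => v0; last by rewrite gt0_muley ?lte_fin// -EFinM addey ?leey.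
rewrite ifT; last by rewrite addr_gt0// mulr_gt0.
by rewrite lee_fin convex_function_ineq// !ltW.
Qed.

(** The end points t = 0 and t = 1 are treated apart because of the convention
    0 * +oo = 0. *)
Lemma f_fun_convex (R : realType) (phi : R -> R) (d s : nat)
    (xi xi' : 'rV[R]_d) (t : R) :
  convex_function [set t : R^o | 0 < t] phi -> 0 <= t <= 1 ->
  (f_fun phi s (t *: xi + (1 - t) *: xi') <=
   t%:E * f_fun phi s xi + (1 - t)%:E * f_fun phi s xi')%E.
Proof.
move=> cphi /andP[]; rewrite le_eqVlt => /predU1P[<- _|t0].
  by rewrite scale0r add0r subr0 scale1r mul0e add0e mul1e.
rewrite le_eqVlt => /predU1P[->|t1].
  by rewrite subrr scale0r addr0 scale1r mul0e adde0 mul1e.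
rewrite /f_fun !sume_distrr_gtNy; try by move=> *; exact: ext_pos_gtNy.
rewrite -big_split /=; apply: lee_sum => i _.
by rewrite !mxE ext_pos_convex// t0.
Qed.

Lemma psdmx_conv (R : realType) (d : nat) (M M' : 'M[R]_d) (t : R) :
  psdmx M -> psdmx M' -> 0 <= t <= 1 -> psdmx (t *: M + (1 - t) *: M').
Proof.
move=> [sM pM] [sM' pM'] /andP[t0 t1]; split.
  by rewrite linearD/= !linearZ/= sM sM'.
move=> v; rewrite mulmxDr mulmxDl -!scalemxAr -!scalemxAl.
have := pM' v; have := pM v.
move: (v *m M *m _) (v *m M' *m _) => B B' B0 B0'; rewrite !mxE.
by rewrite addr_ge0// mulr_ge0// subr_ge0.
Qed.

Lemma psd_eigenvalues_ge0 (R : realType) (d : nat) (M : 'M[R]_d) :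
  psdmx M -> nonneg_vec (eigenvalues M).
Proof.
move=> [sM pM] i; have [Q [_ _ QMQ]] := eigenvalues_spectral sM.
have := pM (row i Q).
by rewrite quad_form_row QMQ mxE eqxx mulr1n.
Qed.

Lemma eigenvalues_nonincr (R : realType) (d : nat) (M : 'M[R]_d) :
  M^T = M -> nonincreasing_vec (eigenvalues M).
Proof. by move=> sM; have [Q []] := eigenvalues_spectral sM. Qed.

(** Majorization of a spectrum as a family of constraints that are linear in M
    and xi, indexed by the orthogonal matrices. *)
Lemma majorizes_eigenvalues (R : realType) (d : nat) (M : 'M[R]_d)
    (xi : 'rV[R]_d) : M^T = M -> nonincreasing_vec xi ->
  majorizes xi (eigenvalues M) <->
  \sum_i xi 0 i = \tr M /\
  forall j (Q : 'M[R]_d), (j < d)%N -> Q *m Q^T = 1%:M ->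
    \sum_(i < d | (i < j)%N) (Q *m M *m Q^T) i i <=
    \sum_(i < d | (i < j)%N) xi 0 i.
Proof.
move=> sM sxi; have sl := eigenvalues_nonincr sM.
rewrite /majorizes trace_eigenvalues//; split=> -[tot maj]; split=> //.
  move=> j Q jd QQ; apply: le_trans (ky_fan sM QQ (ltnW jd)) _.
  by have := maj j jd; rewrite !sum_desc_entriesE 1?ltnW.
move=> j jd; rewrite !sum_desc_entriesE 1?ltnW//.
have [Q [QQ _ QMQ]] := eigenvalues_spectral sM.
apply: le_trans (maj j Q jd QQ); rewrite QMQ.
by apply: ler_sum => i _; rewrite mxE eqxx mulr1n.
Qed.

(** Optimal vectors for M and M' combine to an admissible vector for the
    combination of M and M'. *)
Lemma h_eigenvalues_convex (R : realType) (phi : R -> R) (d s : nat)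
    (M M' : 'M[R]_d) (t : R) :
  convex_function [set t : R^o | 0 < t] phi ->
  (forall t u : R, 0 < t -> t <= u -> phi u <= phi t) ->
  (0 < s)%N -> (s <= d)%N -> psdmx M -> psdmx M' -> 0 <= t <= 1 ->
  (h_fun phi s (eigenvalues (t *: M + (1 - t) *: M')) <=
   t%:E * h_fun phi s (eigenvalues M) +
   (1 - t)%:E * h_fun phi s (eigenvalues M'))%E.
Proof.
move=> cphi nphi s0 sd pM pM' t01; have /andP[t0 t1] := t01.
have t1' : 0 <= 1 - t by rewrite subr_ge0.
have [sM _] := pM; have [sM' _] := pM'.
have [xi [xi0 maj sxi] <-] :=
  h_fun_attained phi s0 sd (psd_eigenvalues_ge0 pM).
have [xi' [xi0' maj' sxi'] <-] :=
  h_fun_attained phi s0 sd (psd_eigenvalues_ge0 pM').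
apply: le_trans (f_fun_convex s xi xi' cphi t01).
have [tot kf] := (majorizes_eigenvalues sM sxi).1 maj.
have [tot' kf'] := (majorizes_eigenvalues sM' sxi').1 maj'.
have pN := psdmx_conv pM pM' t01; have [sN _] := pN.
apply: h_fun_le => //; first exact: psd_eigenvalues_ge0.
have sxit : nonincreasing_vec (t *: xi + (1 - t) *: xi').
  by move=> i j ij; rewrite !mxE lerD// ler_wpM2l//; [exact: sxi|exact: sxi'].
split=> //; first by move=> i; rewrite !mxE addr_ge0// mulr_ge0.
apply/majorizes_eigenvalues => //; split.
  rewrite linearD/= !linearZ/= -tot -tot' !mulr_sumr -big_split /=.
  by apply: eq_bigr => i _; rewrite !mxE.
move=> j Q jd QQ.
rewrite [leRHS](_ : _ = t * \sum_(i < d | (i < j)%N) xi 0 i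
    + (1 - t) * \sum_(i < d | (i < j)%N) xi' 0 i); last first.
  by rewrite !mulr_sumr -big_split; apply: eq_bigr => i _; rewrite !mxE.
rewrite [leLHS](_ : _ = t * \sum_(i < d | (i < j)%N) (Q *m M *m Q^T) i i
    + (1 - t) * \sum_(i < d | (i < j)%N) (Q *m M' *m Q^T) i i); last first.
  rewrite mulmxDr mulmxDl -!scalemxAr -!scalemxAl.
  rewrite !mulr_sumr -big_split; apply: eq_bigr => i _ /=.
  by move: (Q *m M *m _) (Q *m M' *m _) => B B'; rewrite !mxE.
by rewrite lerD// ler_wpM2l//; [exact: kf|exact: kf'].
Qed.

(** * Attainment over the feasible set *)

Lemma psdmx_VDVt (R : realType) (d : nat) (V : 'M[R]_d) (x : 'rV[R]_d) :
  (forall i, 0 <= x 0 i) -> psdmx (VDVt V x).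
Proof.
move=> x0; split; first by rewrite /VDVt !trmx_mul trmxK tr_diag_mx mulmxA.
move=> v; have -> : v *m VDVt V x *m v^T = v *m V *m diag_mx x *m (v *m V)^T.
  by rewrite /VDVt trmx_mul !mulmxA.
rewrite mulmx_trE sumr_ge0// => k _; rewrite mul_mx_diag mxE.
by rewrite mulrAC -expr2 mulr_ge0 ?sqr_ge0.
Qed.

Lemma diag_conj_VDVt (R : realType) (d : nat) (V Q : 'M[R]_d) (x : 'rV[R]_d) i :
  (Q *m VDVt V x *m Q^T) i i = \sum_k ((Q *m V) i k) ^+ 2 * x 0 k.
Proof.
have -> : Q *m VDVt V x *m Q^T = Q *m V *m diag_mx x *m (Q *m V)^T.
  by rewrite /VDVt trmx_mul !mulmxA.
rewrite mul_mx_diag; move: (Q *m V) => W; rewrite mxE.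
by apply: eq_bigr => k _; rewrite !mxE mulrAC expr2.
Qed.

Lemma trace_VDVt (R : realType) (d : nat) (V : 'M[R]_d) (x : 'rV[R]_d) :
  \tr (VDVt V x) = \sum_i \sum_k (V i k) ^+ 2 * x 0 k.
Proof.
apply: eq_bigr => i _; have := diag_conj_VDVt V 1%:M x i.
by rewrite trmx1 mulmx1 !mul1mx.
Qed.

(** The domain of the joint minimization over x and xi. *)
Definition feasible_pairs (R : realType) (d m s : nat) (V : 'M[R]_d)
    (A : 'M[R]_(m, d)) (b : 'cV[R]_m) : set ('rV[R]_d * 'rV[R]_d) :=
  [set z | feasible s A b z.1 /\ admissible (eigenvalues (VDVt V z.1)) z.2].

(** Boundedness: a nonnegative xi is bounded by the sum of its entries, which is
    the trace of V Diag(x) V^T, at most the sum of the squares of the entries of V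
    when x has entries in [0, 1].  Closedness: all constraints compare continuous
    functions of (x, xi), the spectrum being replaced by the Ky Fan
    inequalities. *)
Lemma feasible_pairs_compact (R : realType) (d m s : nat) (V : 'M[R]_d)
    (A : 'M[R]_(m, d)) (b : 'cV[R]_m) : compact (feasible_pairs s V A b).
Proof.
pose B := \sum_i \sum_k (V i k) ^+ 2.
apply: (@subclosed_compact _ _ ([set x : 'rV[R]_d | forall i, 0 <= x 0 i <= 1]
  `*` [set xi : 'rV[R]_d | forall i, 0 <= xi 0 i <= B])); last first.
- move=> [x xi] [/= [x01 _ _] [xi0 maj sxi]]; split=> //= i.
  rewrite xi0 /=; have x0 j : 0 <= x 0 j by have /andP[] := x01 j.
  have [tot _] := (majorizes_eigenvalues (psdmx_VDVt V x0).1 sxi).1 maj.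
  apply: (@le_trans _ _ (\sum_i xi 0 i)).
    by rewrite (bigD1 i)//= lerDl sumr_ge0.
  rewrite tot trace_VDVt; apply: ler_sum => j _; apply: ler_sum => k _.
  by rewrite ler_piMr ?sqr_ge0//; have /andP[] := x01 k.
- by apply: compact_setX; exact: rV_box_compact.
have c1 j : continuous (fun z : 'rV[R]_d * 'rV[R]_d => z.1 0 j).
  move=> z; have cf : {for z, continuous (@fst 'rV[R]_d 'rV[R]_d)} by exact: cvg_fst.
  exact: (continuous_comp cf (@coord_continuous R 1 d 0 j z.1)).
have c2 j : continuous (fun z : 'rV[R]_d * 'rV[R]_d => z.2 0 j).
  move=> z; have cf : {for z, continuous (@snd 'rV[R]_d 'rV[R]_d)} by exact: cvg_snd.
  exact: (continuous_comp cf (@coord_continuous R 1 d 0 j z.2)).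
have clin (a : 'I_d -> R) :
    continuous (fun z : 'rV[R]_d * 'rV[R]_d => \sum_k a k * z.1 0 k).
  apply: (@continuous_sum _ _ _ _ _ (fun k (z : 'rV[R]_d * 'rV[R]_d) =>
    a k * z.1 0 k)) => k _.
  by apply: (@continuous_mul _ _ (fun z => _)) => //; exact: cst_continuous.
have sum2 (P : pred 'I_d) :
    continuous (fun z : 'rV[R]_d * 'rV[R]_d => \sum_(k | P k) z.2 0 k).
  by apply: (@continuous_sum _ _ _ _ _ (fun k (z : 'rV[R]_d * 'rV[R]_d) =>
    z.2 0 k)).
have cc (a : R) : continuous (fun _ : 'rV[R]_d * 'rV[R]_d => a).
  exact: cst_continuous.
(* The factor 1 gives the sum of the entries of x the form covered by clin. *)
have -> : feasible_pairs s V A b =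
  [set z : 'rV[R]_d * 'rV[R]_d | forall i : 'I_d, True -> 0 <= z.1 0 i] `&`
  [set z : 'rV[R]_d * 'rV[R]_d | forall i : 'I_d, True -> z.1 0 i <= 1] `&`
  [set z : 'rV[R]_d * 'rV[R]_d | \sum_k 1 * z.1 0 k = s%:R] `&`
  [set z : 'rV[R]_d * 'rV[R]_d | forall j, True -> \sum_k A j k * z.1 0 k <= b j 0] `&`
  [set z : 'rV[R]_d * 'rV[R]_d | forall i : 'I_d, True -> 0 <= z.2 0 i] `&`
  [set z : 'rV[R]_d * 'rV[R]_d | forall ij : 'I_d * 'I_d,
     (ij.1 <= ij.2)%N -> z.2 0 ij.2 <= z.2 0 ij.1] `&`
  [set z : 'rV[R]_d * 'rV[R]_d |
     \sum_k z.2 0 k = \sum_i \sum_k (V i k) ^+ 2 * z.1 0 k] `&`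
  [set z : 'rV[R]_d * 'rV[R]_d | forall jQ : nat * 'M[R]_d,
     (jQ.1 < d)%N /\ jQ.2 *m jQ.2^T = 1%:M ->
     \sum_(i < d | (i < jQ.1)%N) \sum_k ((jQ.2 *m V) i k) ^+ 2 * z.1 0 k <=
     \sum_(i < d | (i < jQ.1)%N) z.2 0 i].
  apply/seteqP; split=> z.
    move=> [[x01 xs xA] [xi0 maj sxi]].
    have x0 j : 0 <= z.1 0 j by have /andP[] := x01 j.
    have [tot kf] := (majorizes_eigenvalues (psdmx_VDVt V x0).1 sxi).1 maj.
    do 7 (try split) => //=.
    + by move=> i _; have /andP[] := x01 i.
    + by rewrite -xs; apply: eq_bigr => k _; rewrite mul1r.
    + move=> j _; apply: le_trans (xA j); rewrite mxE.
      by apply: ler_sum => k _; rewrite mxE.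
    + by move=> ij; exact: sxi.
    + by rewrite tot trace_VDVt.
    + move=> [j Q] /= [jd QQ]; have := kf j Q jd QQ.
      by rewrite (eq_bigr _ (fun i _ => diag_conj_VDVt V Q z.1 i)).
  move=> [[[[[[[x0 x1] xs] xA] xi0] sxi] tot] kf].
  have {}x0 j : 0 <= z.1 0 j by exact: x0.
  have {}sxi : nonincreasing_vec z.2 by move=> i j; exact: (sxi (i, j)).
  split; split=> //.
  + by move=> i; rewrite x0 x1.
  + by rewrite -xs; apply: eq_bigr => k _; rewrite mul1r.
  + move=> j; apply: le_trans (xA j _) => //; rewrite mxE.
    by apply: ler_sum => k _; rewrite mxE.
  + by move=> i; exact: xi0.
  + apply/(majorizes_eigenvalues (psdmx_VDVt V x0).1 sxi).
    rewrite trace_VDVt; split=> // j Q jd QQ.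
    rewrite (eq_bigr _ (fun i _ => diag_conj_VDVt V Q z.1 i)).
    exact: (kf (j, Q)).
repeat apply: closedI; try by apply: closed_le_family.
- exact: closed_eq_fun.
- apply: closed_eq_fun => //.
  by apply: (@continuous_sum _ _ _ _ _ (fun i (z : 'rV[R]_d * 'rV[R]_d) =>
    \sum_k (V i k) ^+ 2 * z.1 0 k)).
- apply: closed_le_family => // jQ.
  by apply: (@continuous_sum _ _ _ _ _ (fun i (z : 'rV[R]_d * 'rV[R]_d) =>
    \sum_k ((jQ.2 *m V) i k) ^+ 2 * z.1 0 k)).
Qed.

Lemma feasible_pair_optimal (R : realType) (d m s : nat) (V : 'M[R]_d)
    (A : 'M[R]_(m, d)) (b : 'cV[R]_m) (phi : R -> R) (x : 'rV[R]_d) :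
  (0 < s)%N -> (s <= d)%N -> feasible s A b x ->
  exists2 xi, feasible_pairs s V A b (x, xi) &
    f_fun phi s xi = h_fun phi s (eigenvalues (VDVt V x)).
Proof.
move=> s0 sd Xx; have [x01 _ _] := Xx.
have x0 j : 0 <= x 0 j by have /andP[] := x01 j.
have [xi adm fxi] :=
  h_fun_attained phi s0 sd (psd_eigenvalues_ge0 (psdmx_VDVt V x0)).
by exists xi.
Qed.

Lemma f_fun_lsc (R : realType) (phi : R -> R) (d s : nat) :
  lower_semicontinuous (ext_pos phi) ->
  lower_semicontinuous (fun xi : 'rV[R]_d => f_fun phi s xi).
Proof.
move=> lphi; apply: (@lower_semicontinuous_sum _ _ _ _ _
  (fun i (xi : 'rV[R]_d) => ext_pos phi (xi 0 i))) => [i xi|i].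
  exact: ext_pos_gtNy.
apply: (@lower_semicontinuous_comp _ _ _ (fun xi : 'rV[R]_d => xi 0 i)) => //.
exact: coord_continuous.
Qed.

(** For a minimizing pair (x, xi), h at x is at most f_s(xi), and f_s(xi) is at
    most h at every feasible y, because h at y is the value of some pair. *)
Lemma h_fun_min_feasible (R : realType) (d m s : nat) (phi : R -> R)
    (V : 'M[R]_d) (A : 'M[R]_(m, d)) (b : 'cV[R]_m) :
  convex_function [set t : R^o | 0 < t] phi ->
  (forall t u : R, 0 < t -> t <= u -> phi u <= phi t) ->
  lower_semicontinuous (ext_pos phi) ->
  (0 < s)%N -> (s <= d)%N -> feasible s A b !=set0 ->
  exists2 x, feasible s A b x & forall y, feasible s A b y ->
    (h_fun phi s (eigenvalues (VDVt V x)) <=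
     h_fun phi s (eigenvalues (VDVt V y)))%E.
Proof.
move=> cphi nphi lphi s0 sd [x0 Xx0].
have [xi0 Kx0 _] := feasible_pair_optimal V phi s0 sd Xx0.
have [|[x xi] [/= Xx adm] zmin] :=
  lsc_compact_min (@feasible_pairs_compact R d m s V A b) (ex_intro _ _ Kx0) (f := fun z => f_fun phi s z.2).
  apply: (@lower_semicontinuous_comp _ _ _ (@snd 'rV[R]_d 'rV[R]_d)).
    by move=> z; exact: cvg_snd.
  exact: f_fun_lsc.
exists x; first exact: Xx.
move=> y Xy; have [xi' Ky <-] := feasible_pair_optimal V phi s0 sd Xy.
apply: (le_trans _ (zmin _ Ky)).
apply: (h_fun_le cphi nphi s0 sd _ adm).
have [x01 _ _] := Xx; apply/psd_eigenvalues_ge0/psdmx_VDVt => j.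
by have /andP[] := x01 j.
Qed.

Theorem corollary2 (R : realType) (d s m : nat) (phi : R -> R)
    (V : 'M[R]_d) (A : 'M[R]_(m, d)) (b : 'cV[R]_m)
    (phi_convex : convex_function [set t : R^o | 0 < t] phi)
    (phi_nonincreasing :
      forall t u : R, 0 < t -> t <= u -> phi u <= phi t)
    (phi_closed : lower_semicontinuous (ext_pos phi))
    (s_gt0 : (1 <= s)%N) (s_le_d : (s <= d)%N)
    (s_le_rank : (s <= \rank (V^T *m V))%N) :
  let X := feasible s A b in
  let g x := g_fun phi s (eigenvalues (VDVt V x)) in
  let h x := h_fun phi s (eigenvalues (VDVt V x)) in
  [/\ ereal_convex_on [set x | psdmx (VDVt V x)] h,
      (* the minima are infima which are attained *)
      forall l : 'rV[R]_d, nonneg_vec l -> g_values phi s l (g_fun phi s l),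
      X !=set0 -> (g @` X) (ereal_inf (g @` X)) /\
                  (h @` X) (ereal_inf (h @` X))
    & ereal_inf (g @` X) = ereal_inf (h @` X)].
Proof.
move=> X g h.
have VDVt_conv (x y : 'rV[R]_d) (t : R) : VDVt V (t *: x + (1 - t) *: y) =
    t *: VDVt V x + (1 - t) *: VDVt V y.
  rewrite /VDVt linearD/= !linearZ/= mulmxDr mulmxDl.
  by rewrite -!scalemxAr -!scalemxAl.
have ghX x : X x -> g x = h x.
  move=> [x01 _ _]; apply: g_fun_h_fun => //.
  by apply/psd_eigenvalues_ge0/psdmx_VDVt => j; have /andP[] := x01 j.
have ghimg : g @` X = h @` X.
  apply/seteqP; split=> _ [x Xx <-]; exists x => //; last exact: ghX.
  by rewrite ghX.
split; last by rewrite ghimg.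
- split.
    move=> x y t /set_mem /= px /set_mem /= py; apply/mem_set => /=.
    by rewrite VDVt_conv; apply: psdmx_conv => //; rewrite ge0 le1.
  move=> x y t px py t01; rewrite /h VDVt_conv.
  exact: h_eigenvalues_convex.
- move=> l l0; rewrite g_fun_h_fun//.
  by have [xi adm <-] := h_fun_attained phi s_gt0 s_le_d l0; exists xi.
- move=> X0; rewrite ghimg; suff hX : (h @` X) (ereal_inf (h @` X)) by [].
  have [x Xx xmin] := h_fun_min_feasible V phi_convex phi_nonincreasing
    phi_closed s_gt0 s_le_d X0.
  exists x => //; apply/esym/ereal_inf_min; first by exists x.
  by move=> _ [y Xy <-]; exact: xmin.
Qed.
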